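(* Let $k$ be an algebraically closed field, $Q$ a quiver, $\Sigma\subset\mathrm{Aut}^+(Q)$ a subgroup, and $d,\theta$ $\Sigma$-compatible. Then $(\mathrm{Im}\,f^{rs}_\Sigma)(k)\subset\mathcal{T}^{-1}([1])$, where $[1]\in H^2(\Sigma,\Delta(k))$ is the trivial class.
   Context: A quiver $Q=(V,A,h,t)$ has finite vertex set $V$, finite arrow set $A$, head and tail maps $h,t:A\to V$. For $d\in\mathbb{N}^V$, $\mathrm{Rep}_{Q,d}=\prod_{a\in A}\mathrm{Mat}_{d_{h(a)}\times d_{t(a)}}$ with the action of $\mathbf{G}_{Q,d}=\prod_v\mathbf{GL}_{d_v}$ given by $g\cdot M=(g_{h(a)}M_ag_{t(a)}^{-1})_a$; $\Delta=\{(tI_{d_v})_v:t\in\mathbb{G}_m\}$. For $\theta\in\mathbb{Z}^V$, a nonzero representation $W$ is $\theta$-stable if $\mu_\theta(W')<\mu_\theta(W)$ for all subrepresentations $0\ne W'\subsetneq W$, where $\mu_\theta(W)=\sum_v\theta_v\dim W_v/\sum_v\dim W_v$. Let $\mathrm{Rep}_{Q,d}^{\chi_\theta\text{-}s}$ be the open locus of $\theta$-stable points (the GIT stable locus for the character $\chi_\theta(g)=\prod_v(\det g_v)^{-\theta'_v}$, $\theta'_v=\theta_v\sum_\alpha d_\alpha-\sum_\alpha\theta_\alpha d_\alpha$) and $\mathcal{M}^{\theta\text{-}s}_{Q,d}=\mathrm{Rep}_{Q,d}^{\chi_\theta\text{-}s}/\mathbf{G}_{Q,d}$ the geometric quotient.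 The stabiliser of a stable point is $\Delta(k)$. $\mathrm{Aut}^+(Q)$ is the group of pairs of bijections $\sigma:V\to V$, $\sigma:A\to A$ with $t\sigma=\sigma t$, $h\sigma=\sigma h$. $d,\theta$ are $\Sigma$-compatible if $d_{\sigma(v)}=d_v$, $\theta_{\sigma(v)}=\theta_v$ for all $\sigma\in\Sigma$, $v\in V$. $\Sigma$ acts on $\mathrm{Rep}_{Q,d}$ by $\sigma(M)=(M_{\sigma(a)})_a$ and on $\mathbf{G}_{Q,d}$ by $\sigma(g)=(g_{\sigma(v)})_v$ (product in $\Sigma$ written so that these are left actions), trivially on $\Delta$, and hence on $\mathcal{M}^{\theta\text{-}s}_{Q,d}$; superscript $\Sigma$ denotes fixed loci. $f^{rs}_\Sigma:(\mathrm{Rep}_{Q,d}^\Sigma\cap\mathrm{Rep}_{Q,d}^{\chi_\theta\text{-}s})/\mathbf{G}_{Q,d}^\Sigma\to(\mathcal{M}^{\theta\text{-}s}_{Q,d})^\Sigma$ is the morphism induced by the inclusion. Type map $\mathcal{T}:(\mathcal{M}^{\theta\text{-}s}_{Q,d})^\Sigma(k)\to H^2(\Sigma,\Delta(k))$: for $m=\mathbf{G}_{Q,d}\cdot M$ choose $u_\sigma\in\mathbf{G}_{Q,d}(k)$ with $u_\sigma\cdot\sigma(M)=M$ for each $\sigma\in\Sigma$; then $\mathcal{T}(m)$ is the class of the 2-cocycle $(\sigma_1,\sigma_2)\mapsto u_{\sigma_1}\sigma_1(u_{\sigma_2})u_{\sigma_1\sigma_2}^{-1}\in\Delta(k)$,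 which is independent of the choices. *)

(* Defs.v *)
From HB Require Import structures.
From mathcomp Require Import all_boot all_order all_fingroup all_algebra.
From mathcomp Require Import boolp classical_sets.

Set Implicit Arguments.
Unset Strict Implicit.
Unset Printing Implicit Defensive.

Import Order.TTheory GRing.Theory Num.Theory GroupScope.
Local Open Scope classical_set_scope.
Local Open Scope ring_scope.

Record quiver := Quiver {
  vert : finType;
  arrow : finType;
  qhead : arrow -> vert;
  qtail : arrow -> vert }.

Section Automorphisms.
Variable Q : quiver.

Definition qaut_set : {set {perm vert Q} * {perm arrow Q}} :=
  [set s : {perm vert Q} * {perm arrow Q} |
    [forall a, (qtail (s.2 a) == s.1 (qtail a)) &&
               (qhead (s.2 a) == s.1 (qhead a))]]%SET.

Lemma qaut_group_set : group_set qaut_set.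
Proof.
apply/group_setP; split.
  by rewrite inE; apply/forallP=> a; rewrite !perm1 !eqxx.
move=> s t; rewrite !inE => /forallP hs /forallP ht; apply/forallP=> a /=.
case/andP: (hs a) => /eqP e1 /eqP e2; rewrite !permM.
by case/andP: (ht (s.2 a)) => /eqP-> /eqP->; rewrite e1 e2 !eqxx.
Qed.

Canonical qaut_group := Group qaut_group_set.

(* Aut^+(Q).  As for all permutations in the library, [s * t] is [s] followed
   by [t]; this is the convention for which M |-> (M_{sigma(a)})_a is a left
   action. *)
Definition qaut := subg_of qaut_group.
HB.instance Definition _ := FinGroup.on qaut.

Definition autV (s : qaut) : {perm vert Q} := (sgval s).1.
Definition autA (s : qaut) : {perm arrow Q} := (sgval s).2.

Lemma qaut_tail (s : qaut) a : qtail (autA s a) = autV s (qtail a).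
Proof. by have := subgP s; rewrite inE => /forallP/(_ a)/andP[/eqP]. Qed.

Lemma qaut_head (s : qaut) a : qhead (autA s a) = autV s (qhead a).
Proof. by have := subgP s; rewrite inE => /forallP/(_ a)/andP[_ /eqP]. Qed.

Lemma autVM (s t : qaut) v : autV (s * t)%g v = autV t (autV s v).
Proof. by rewrite /autV /= permM. Qed.

Lemma autAM (s t : qaut) a : autA (s * t)%g a = autA t (autA s a).
Proof. by rewrite /autA /= permM. Qed.

Definition compatible (T : Type) (Sigma : {group qaut}) (f : vert Q -> T) :=
  forall s : qaut, s \in Sigma -> forall v, f (autV s v) = f v.

End Automorphisms.

(* Second cohomology of a group with coefficients in an abelian group on which
   it acts trivially; its elements are the cosets of the 2-coboundaries in the
   2-cocycles. *)
Section H2.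
Variables (gT : finGroupType) (A : groupType).
Local Open Scope group_scope.

Definition cocycle2 (c : gT -> gT -> A) :=
  forall x y z, c y z * c x (y * z) = c x y * c (x * y) z.

Definition coboundary2 (b : gT -> A) : gT -> gT -> A :=
  fun x y => b x * b y * (b (x * y))^-1.

Definition coset2 (c : gT -> gT -> A) : set (gT -> gT -> A) :=
  [set c' | exists b : gT -> A, c' = (fun x y => c x y * coboundary2 b x y)].

Definition H2 :=
  {C : set (gT -> gT -> A) | exists2 c, cocycle2 c & C = coset2 c}.

Definition H2class (c : gT -> gT -> A) (hc : cocycle2 c) : H2 :=
  exist _ (coset2 c) (ex_intro2 _ _ c hc erefl).

Lemma cocycle2_1 : cocycle2 (fun _ _ => 1).
Proof. by []. Qed.

Definition H2_1 : H2 := H2class cocycle2_1.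

End H2.

Section Representations.
Variables (k : closedFieldType) (Q : quiver) (d : vert Q -> nat).
Notation V := (vert Q).

Definition rep := forall a : arrow Q, 'M[k]_(d (qhead a), d (qtail a)).

Record GQ := MkGQ {
  GQval :> {dffun forall v : V, 'M[k]_(d v)};
  GQ_unit : [forall v, GQval v \in unitmx] }.

HB.instance Definition _ := [isSub for GQval].
HB.instance Definition _ := [Choice of GQ by <:].

Lemma GQunit (g : GQ) v : g v \in unitmx.
Proof. by have /forallP := GQ_unit g. Qed.

Lemma GQext (g h : GQ) : (forall v, g v = h v) -> g = h.
Proof. by move=> e; apply/val_inj/ffunP. Qed.

Lemma GQ_of_subproof (f : forall v : V, 'M[k]_(d v))
  (hf : forall v, f v \in unitmx) :
  [forall v, [ffun v => f v] v \in unitmx].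
Proof. by apply/forallP=> v; rewrite ffunE. Qed.

Definition GQ_of (f : forall v : V, 'M[k]_(d v)) hf : GQ :=
  MkGQ (@GQ_of_subproof f hf).

Lemma GQ_ofE f hf v : @GQ_of f hf v = f v.
Proof. by rewrite ffunE. Qed.

Lemma GQ_one_subproof v : (1%:M : 'M[k]_(d v)) \in unitmx.
Proof. exact: unitmx1. Qed.
Lemma GQ_mul_subproof (g h : GQ) v : g v *m h v \in unitmx.
Proof. by rewrite unitmx_mul !GQunit. Qed.
Lemma GQ_inv_subproof (g : GQ) v : invmx (g v) \in unitmx.
Proof. by rewrite unitmx_inv GQunit. Qed.

Definition GQ_one := GQ_of GQ_one_subproof.
Definition GQ_mul g h := GQ_of (GQ_mul_subproof g h).
Definition GQ_inv g := GQ_of (GQ_inv_subproof g).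

Lemma GQ_mulA : associative GQ_mul.
Proof. by move=> x y z; apply: GQext => v; rewrite !GQ_ofE mulmxA. Qed.
Lemma GQ_mul1 : left_id GQ_one GQ_mul.
Proof. by move=> x; apply: GQext => v; rewrite !GQ_ofE mul1mx. Qed.
Lemma GQ_mulr1 : right_id GQ_one GQ_mul.
Proof. by move=> x; apply: GQext => v; rewrite !GQ_ofE mulmx1. Qed.
Lemma GQ_mulV : left_inverse GQ_one GQ_inv GQ_mul.
Proof. by move=> x; apply: GQext => v; rewrite !GQ_ofE mulVmx ?GQunit. Qed.
Lemma GQ_mulVr : right_inverse GQ_one GQ_inv GQ_mul.
Proof. by move=> x; apply: GQext => v; rewrite !GQ_ofE mulmxV ?GQunit. Qed.

HB.instance Definition _ :=
  isGroup.Build GQ GQ_mulA GQ_mul1 GQ_mulr1 GQ_mulV GQ_mulVr.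

Lemma GQ1E v : (1%g : GQ) v = 1%:M.
Proof. exact: GQ_ofE. Qed.
Lemma GQME (g h : GQ) v : (g * h)%g v = g v *m h v.
Proof. exact: GQ_ofE. Qed.
Lemma GQVE (g : GQ) v : (g^-1)%g v = invmx (g v).
Proof. exact: GQ_ofE. Qed.

Definition Delta_pred : {pred GQ} :=
  fun g => `[< exists2 t : k, t != 0 & forall v, g v = t%:M >].

Lemma Delta_closed : group_closed Delta_pred.
Proof.
split=> [|g h /asboolP[x x0 hx] /asboolP[y y0 hy]]; apply/asboolP.
  by exists 1; [exact: oner_neq0 | exact: GQ1E].
exists (x / y) => [|v]; first by rewrite mulf_neq0 ?invr_eq0.
by rewrite GQME GQVE hx hy invmx_scalar -scalar_mxM.
Qed.

Record Delta := MkDelta { Dval :> GQ; Dval_in : Dval \in Delta_pred }.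
HB.instance Definition _ := [isSub for Dval].
HB.instance Definition _ := [Choice of Delta by <:].
HB.instance Definition _ :=
  SubChoice_isSubGroup.Build GQ Delta_pred Delta Delta_closed.

Definition actG (g : GQ) (M : rep) : rep :=
  fun a => g (qhead a) *m M a *m invmx (g (qtail a)).

Lemma Delta_central g h : g \in Delta_pred -> (g * h = h * g)%g.
Proof.
case/asboolP=> t _ ht; apply: GQext => v.
by rewrite !GQME ht scalar_mxC.
Qed.

Lemma actG1 M : actG 1%g M = M.
Proof.
apply: functional_extensionality_dep => a.
by rewrite /actG !GQ1E invmx1 mul1mx mulmx1.
Qed.

Lemma actGM g h M : actG (g * h)%g M = actG g (actG h M).
Proof.
apply: functional_extensionality_dep => a.
by rewrite /actG -!GQVE invgM !GQME !mulmxA.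
Qed.

Definition orbitG (M : rep) : set rep := [set N | exists g, N = actG g M].

Definition subrep (M : rep) (W : forall v : V, {vspace 'cV[k]_(d v)}) :=
  forall a (x : 'cV[k]_(d (qtail a))),
    x \in W (qtail a) -> M a *m x \in W (qhead a).

(* The slope of a representation of dimension vector [e]. *)
Definition slope (theta : V -> int) (e : V -> nat) : rat :=
  (\sum_v theta v * (e v)%:Z)%:~R / (\sum_v e v)%:R.

Definition stable (theta : V -> int) (M : rep) :=
  (exists v, d v != 0%N) /\
  forall W : (forall v : V, {vspace 'cV[k]_(d v)}),
    subrep M W -> (exists v, W v <> 0%VS) -> (exists v, W v <> fullv) ->
    slope theta (fun v => \dim (W v)) < slope theta d.

Variable theta : V -> int.

Lemma slope_sum (a b : V -> nat) :
  (forall v, a v + b v = d v)%N -> (exists v, a v != 0%N) ->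
  (exists v, b v != 0%N) ->
  slope theta a < slope theta d -> slope theta b < slope theta d -> False.
Proof.
move=> ab [va a0] [vb b0].
have pos (e : V -> nat) v : e v != 0%N -> 0 < (\sum_v e v)%:R :> rat.
  by rewrite -lt0n ltr0n => ev; rewrite (bigD1 v) //= addn_gt0 ev.
set c := slope theta d; rewrite /slope !ltr_pdivrMr; last 2 first.
- exact: pos b0.
- exact: pos a0.
move=> ha hb; have := ltrD ha hb; rewrite -mulrDr -natrD -intrD -!big_split /=.
rewrite (eq_bigr d) => [|v _]; last exact: ab.
rewrite [X in X%:~R](eq_bigr (fun v => theta v * (d v)%:Z)) => [|v _].
  rewrite /c /slope divfK ?ltxx // gt_eqF //; apply: (pos d va).
  by rewrite -ab addn_eq0 negb_and a0.
by rewrite -mulrDr -PoszD ab.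
Qed.

(* Schur's lemma: the kernel K and the image I of g - t, for t an eigenvalue of
   some g_v, are subrepresentations with dim K + dim I = d. *)
Lemma stable_stab M (g : GQ) :
  stable theta M -> actG g M = M -> g \in Delta_pred.
Proof.
move=> [[v0 dv0] hM] hg.
have com a : g (qhead a) *m M a = M a *m g (qtail a).
  by rewrite -{2}hg /actG mulmxKV ?GQunit.
have [t /eigenvalueP[x hx x0]] : exists t, eigenvalue (g v0)^T t.
  have /closed_rootP[t ht] : size (char_poly (g v0)^T) != 1%N.
    by rewrite size_char_poly eqSS.
  by exists t; rewrite eigenvalue_root_char.
pose f v := linfun (mulmx (g v - t%:M)) : 'Hom('cV[k]_(d v), 'cV[k]_(d v)).
have fE v y : f v y = g v *m y - t *: y.
  by rewrite lfunE /= mulmxBl mul_scalar_mx.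
have fM a y : f (qhead a) (M a *m y) = M a *m f (qtail a) y.
  by rewrite !fE mulmxBr mulmxA com -mulmxA scalemxAr.
pose K v := lker (f v); pose I v := limg (f v).
have dimKI v : (\dim (K v) + \dim (I v) = d v)%N.
  have := limg_ker_dim (f v) fullv; rewrite capfv dimvf.
  by rewrite /dim /= muln1.
have K0 : K v0 <> 0%VS.
  move=> e; have : x^T \in K v0.
    by rewrite memv_ker fE -[g v0]trmxK -trmx_mul hx linearZ /= subrr.
  rewrite e memv0 => /eqP/(congr1 trmx); rewrite trmxK trmx0 => x1.
  by rewrite x1 eqxx in x0.
have I1 : I v0 <> fullv.
  move=> e; apply: K0; apply/eqP; rewrite -dimv_eq0.
  have := dimKI v0; rewrite e dimvf /dim /= muln1 -[RHS]add0n.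
  by move/addIn->.
have [allK|/existsNP[v1 K1]] := pselect (forall v, K v = fullv).
  have gt v : g v = t%:M.
    apply/eqP; rewrite -subr_eq0; apply/eqP.
    apply/matrixP=> i j; have : delta_mx j 0 \in K v by rewrite allK memvf.
    rewrite memv_ker lfunE /= -colE => /eqP/matrixP/(_ i 0).
    by rewrite !mxE.
  apply/asboolP; exists t => //; apply/eqP => t0.
  have := GQunit g v0; rewrite gt t0 unitmxE det_scalar expr0n (negbTE dv0).
  by rewrite unitr0.
have I0 : I v1 <> 0%VS.
  move=> e; apply: K1; apply/eqP; rewrite eqEdim subvf dimvf /dim /= muln1.
  by rewrite -{1}(dimKI v1) e dimv0 addn0.
exfalso; apply: (slope_sum dimKI).
- by exists v0; rewrite dimv_eq0; apply/eqP.
- by exists v1; rewrite dimv_eq0; apply/eqP.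
- apply: hM; [|by exists v0|by exists v1] => a y.
  by rewrite !memv_ker fM => /eqP->; rewrite mulmx0.
- apply: hM; [|by exists v1|by exists v0] => a y.
  by case/memv_imgP=> z _ ->; rewrite -fM memv_img ?memvf.
Qed.

(* The k-points of the moduli space.  Over an algebraically closed field the
   k-points of a geometric quotient are the orbits on k-points, here represented
   as sets of representations. *)
Definition moduli :=
  {m : set rep | exists2 M, stable theta M & m = orbitG M}.

Variables (Sigma : {group qaut Q}) (hd : compatible Sigma d).

Lemma compat_vert (s : subg_of Sigma) v : d (autV (sgval s) v) = d v.
Proof. by apply: hd; exact: subgP. Qed.

Lemma compat_head (s : subg_of Sigma) a :
  d (qhead (autA (sgval s) a)) = d (qhead a).
Proof. by rewrite qaut_head compat_vert. Qed.

Lemma compat_tail (s : subg_of Sigma) a :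
  d (qtail (autA (sgval s) a)) = d (qtail a).
Proof. by rewrite qaut_tail compat_vert. Qed.

(* M |-> (M_{sigma(a)})_a; the cast only identifies matrices whose sizes agree
   by compatibility of [d]. *)
Definition sigR (s : subg_of Sigma) (M : rep) : rep :=
  fun a => castmx (compat_head s a, compat_tail s a) (M (autA (sgval s) a)).

Lemma sigG_subproof (s : subg_of Sigma) (g : GQ) v :
  castmx (compat_vert s v, compat_vert s v) (g (autV (sgval s) v)) \in unitmx.
Proof.
by move: (compat_vert s v) (GQunit g (autV (sgval s) v)); case: _ /.
Qed.

Definition sigG (s : subg_of Sigma) (g : GQ) : GQ :=
  GQ_of (sigG_subproof s g).

Lemma sigRM s t M : sigR (s * t)%g M = sigR s (sigR t M).
Proof.
apply: functional_extensionality_dep => a; rewrite /sigR castmx_comp.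
have e : autA (sgval (s * t)%g) a = autA (sgval t) (autA (sgval s) a).
  exact: autAM.
move: (compat_head _ a) (compat_tail _ a) (etrans _ _) (etrans _ _).
rewrite e => h1 h2 h3 h4.
by congr (castmx (_, _) _); exact: eq_irrelevance.
Qed.

Lemma sigGM s t g : sigG (s * t)%g g = sigG s (sigG t g).
Proof.
apply: GQext => v; rewrite !GQ_ofE castmx_comp.
have e : autV (sgval (s * t)%g) v = autV (sgval t) (autV (sgval s) v).
  exact: autVM.
move: (compat_vert _ v) (etrans _ _); rewrite e => h1 h2.
by congr (castmx (_, _) _); exact: eq_irrelevance.
Qed.

Lemma sigG_mul s g h : sigG s (g * h)%g = (sigG s g * sigG s h)%g.
Proof.
apply: GQext => v; rewrite GQME !GQ_ofE.
by move: (compat_vert s v) => e; case: _ / e.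
Qed.

Lemma sig_act s g M : sigR s (actG g M) = actG (sigG s g) (sigR s M).
Proof.
apply: functional_extensionality_dep => a; rewrite /sigR /actG !GQ_ofE.
set v := qhead a; set w := qtail a.
move: (compat_head s a) (compat_tail s a) (compat_vert s v) (compat_vert s w).
move: (M _); rewrite qaut_head qaut_tail -/v -/w => N h1 h2 h3 h4.
rewrite (eq_irrelevance h3 h1) (eq_irrelevance h4 h2).
by move: (g _) (g _) => x y; case: _ / h1; case: _ / h2.
Qed.

Lemma sigG_Delta s g : g \in Delta_pred -> sigG s g = g.
Proof.
case/asboolP=> t _ ht; apply: GQext => v; rewrite GQ_ofE !ht.
by move: (compat_vert s v) => e; case: _ / e.
Qed.

Definition repSigma : set rep := [set M | forall s, sigR s M = M].
Definition GSigma : set GQ := [set g | forall s, sigG s g = g].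

Definition orbitGSigma (M : rep) : set rep :=
  [set N | exists2 g, GSigma g & N = actG g M].

(* The k-points of the quotient of (Rep^Sigma \cap Rep^s) by G^Sigma. *)
Definition rsquot :=
  {o : set rep | exists2 M, repSigma M /\ stable theta M & o = orbitGSigma M}.

(* Sigma acts on orbits by direct image: sigma(G M) = G sigma(M). *)
Definition moduliSigma :=
  {m : moduli | forall s, sigR s @` sval m = sval m}.

(* The orbit of G_{Q,d} containing a given orbit of G_{Q,d}^Sigma. *)
Definition saturate (o : set rep) : set rep :=
  [set N | exists2 M, o M & exists g, N = actG g M].

Lemma saturateE M : saturate (orbitGSigma M) = orbitG M.
Proof.
apply/seteqP; split=> N /=.
  by case=> _ [g _ ->] [h ->]; exists (h * g)%g; rewrite actGM.
case=> g ->; exists M; last by exists g.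
exists 1%g; last by rewrite actG1.
move=> s; apply: GQext => v; rewrite GQ_ofE !GQ1E.
by case: _ / (compat_vert s v).
Qed.

Lemma frs_subproof (o : rsquot) :
  exists2 M, stable theta M & saturate (sval o) = orbitG M.
Proof.
by case: (svalP o) => M [hf hs] ->; exists M; last exact: saturateE.
Qed.

Lemma sigG1 g : sigG 1%g g = g.
Proof.
apply: GQext => v; rewrite GQ_ofE.
have e : autV (sgval (1%g : subg_of Sigma)) v = v by rewrite /autV perm1.
by move: (compat_vert _ v); rewrite e => h; rewrite castmx_id.
Qed.

Lemma frs_fixed (o : rsquot) s :
  sigR s @` saturate (sval o) = saturate (sval o).
Proof.
case: (svalP o) => M [hf hs] ->; rewrite saturateE; apply/seteqP; split=> N /=.
  by case=> _ [g ->] <-; exists (sigG s g); rewrite sig_act hf.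
case=> g ->; exists (actG (sigG s^-1%g g) M); first by exists (sigG s^-1%g g).
by rewrite sig_act hf -sigGM mulgV sigG1.
Qed.

Definition frs (o : rsquot) : moduliSigma :=
  exist _ (exist _ (saturate (sval o)) (frs_subproof o) : moduli)
          (@frs_fixed o).

Section TypeCocycle.
Variables (M : rep) (u : subg_of Sigma -> GQ).
Hypotheses (hM : stable theta M) (hu : forall s, actG (u s) (sigR s M) = M).

Lemma tcocycle_subproof s t :
  (u s * sigG s (u t) * (u (s * t)%g)^-1)%g \in Delta_pred.
Proof.
apply: (stable_stab hM).
have -> : actG (u s * sigG s (u t) * (u (s * t)%g)^-1)%g M
        = actG (u s) (actG (sigG s (u t)) (sigR (s * t)%g M)).
  by rewrite -{1}(hu (s * t)%g) -!actGM mulgKV.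
by rewrite sigRM -sig_act !hu.
Qed.

Definition tcocycle (s t : subg_of Sigma) : Delta :=
  MkDelta (tcocycle_subproof s t).

Lemma tcocycleP : cocycle2 tcocycle.
Proof.
move=> x y z; apply: val_inj.
have DM (a b : Delta) : val (a * b)%g = (val a * val b)%g by [].
rewrite !DM /=; have := tcocycle_subproof y z.
set c := (u y * sigG y (u z) * _)%g => hc.
rewrite (mulgA c) (mulgA c) (Delta_central (u x) hc) -{1}(sigG_Delta x hc).
rewrite -(mulgA (u x)) -sigG_mul /c mulgKV sigG_mul -sigGM.
by rewrite !mulgA mulgKV.
Qed.

End TypeCocycle.

Lemma typemap_subproof (m : moduliSigma) :
  exists Mu : rep * (subg_of Sigma -> GQ),
    [/\ sval (sval m) Mu.1, stable theta Mu.1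
      & forall s, actG (Mu.2 s) (sigR s Mu.1) = Mu.1].
Proof.
case: m => -[m [M hM em]] /= hm; rewrite em in hm *.
have hu s : exists g, actG g (sigR s M) = M.
  have : (sigR s @` orbitG M) (sigR s M).
    by exists M => //; exists 1%g; rewrite actG1.
  rewrite hm => -[g ->]; exists g^-1%g; by rewrite -actGM mulVg actG1.
exists (M, fun s => projT1 (cid (hu s))); split=> //=.
- by exists 1%g; rewrite actG1.
- by move=> s; case: cid.
Qed.

(* The representative M of the orbit m and the elements u_sigma are chosen. *)
Definition typemap (m : moduliSigma) : H2 (subg_of Sigma) Delta :=
  let: exist _ (And3 _ hM hu) := cid (typemap_subproof m) in
  H2class (tcocycleP hM hu).

End Representations.

(* Main.v *)
(** If [M0] is fixed by [Sigma] and [M = h M0], then [u_s sigma_s(M) = M] says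
    that [h^-1 u_s sigma_s(h)] stabilises the stable point [M0], hence is some
    [delta_s] in the central subgroup [Delta], i.e. [u_s sigma_s(h) = delta_s h].
    The type cocycle is then the coboundary of [s |-> delta_s], whatever
    representative [M] and elements [u_s] were chosen. *)
Require Import Defs.
From mathcomp Require Import all_boot all_order all_fingroup all_algebra.
From mathcomp Require Import boolp classical_sets.

Local Open Scope classical_set_scope.

Section H2Coboundary.
Variables (gT : finGroupType) (A : groupType).
Local Open Scope group_scope.

Lemma coboundary2M (b b' : gT -> A) x y : (forall a a' : A, commute a a') ->
  coboundary2 (fun z => b z * b' z) x y
  = coboundary2 b x y * coboundary2 b' x y.
Proof.
move=> Acomm; have mulC (a a' : A) : a * a' = a' * a by apply: Acomm.
rewrite /coboundary2 invgM -!mulgA; congr (_ * _).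
rewrite mulgA (mulC (b' x)) -!mulgA; congr (_ * _).
by rewrite !mulgA mulC !mulgA.
Qed.

Lemma coboundary2V (b : gT -> A) x y : (forall a a' : A, commute a a') ->
  coboundary2 (fun z => (b z)^-1) x y = (coboundary2 b x y)^-1.
Proof.
move=> Acomm; have mulC (a a' : A) : a * a' = a' * a by apply: Acomm.
by rewrite /coboundary2 !invgM [RHS]mulC (mulC (b y)^-1).
Qed.

(** Classes are cosets, so two inclusions are needed: multiplying the cochain [b'] by [b] gives one,
    multiplying it by the inverse of [b] the other. *)
Lemma H2class_coboundary (c : gT -> gT -> A) (hc : cocycle2 c) (b : gT -> A) :
  (forall a a' : A, commute a a') ->
  (forall x y, c x y = coboundary2 b x y) -> H2class hc = H2_1 gT A.
Proof.
move=> Acomm cb; apply: eq_exist; apply/seteqP; split=> _ [b' ->] /=.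
  exists (fun z => b z * b' z); apply/funext => x; apply/funext => y.
  by rewrite mul1g cb coboundary2M.
exists (fun z => (b z)^-1 * b' z); apply/funext => x; apply/funext => y.
by rewrite mul1g cb coboundary2M // coboundary2V // mulKVg.
Qed.

End H2Coboundary.

Section TypeMap.
Variables (k : closedFieldType) (Q : quiver) (d : vert Q -> nat).
Variable theta : vert Q -> int.
Local Open Scope group_scope.

Lemma Delta_mulC (a b : Delta k d) : commute a b.
Proof. by apply: val_inj; exact/Delta_central/Dval_in. Qed.

Lemma stable_actG (h : GQ k d) M g :
  stable theta M -> actG g M = actG h M -> h^-1 * g \in @Delta_pred k Q d.
Proof.
by move=> hM e; apply: (stable_stab hM); rewrite actGM e -actGM mulVg actG1.
Qed.

Variables (Sigma : {group qaut Q}) (hd : compatible Sigma d).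

(** Since [delta t] is central and fixed by [s], [u s * sigG s (u t * sigG t h)] equals
    [delta t * delta s * h], while [u (s * t)] sends [sigG (s * t) h] to [delta (s * t) * h]. *)
Lemma tcocycle_coboundary M (u : subg_of Sigma -> GQ k d) (hM : stable theta M)
    (hu : forall s, actG (u s) (sigR hd s M) = M) (h : GQ k d)
    (delta : subg_of Sigma -> Delta k d) :
  (forall s, u s * sigG hd s h = val (delta s) * h) ->
  forall s t, tcocycle hM hu s t = coboundary2 delta s t.
Proof.
move=> hdelta s t; apply: val_inj => /=.
apply: (canLR (mulgK _)).
apply: (mulIg (sigG hd (s * t) h)).
rewrite -[RHS]mulgA hdelta sigGM -mulgA -sigG_mul hdelta sigG_mul.
rewrite (sigG_Delta hd s (Dval_in _)) mulgA.
rewrite -(Delta_central (u s) (Dval_in (delta t))) -mulgA hdelta !mulgA.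
(* Folding the product back into [Delta] lets [delta (s * t)] cancel there. *)
rewrite -[in RHS]/(val (coboundary2 delta s t * delta (s * t))).
by rewrite /coboundary2 mulgKV (Delta_central _ (Dval_in (delta t))).
Qed.

Lemma H2class_tcocycle_fixed M M0 (h : GQ k d) (u : subg_of Sigma -> GQ k d)
    (hM : stable theta M) (hu : forall s, actG (u s) (sigR hd s M) = M) :
  stable theta M0 -> repSigma hd M0 -> M = actG h M0 ->
  H2class (tcocycleP hM hu) = H2_1 _ _.
Proof.
move=> hM0 fixM0 eM.
have delta_in s : h^-1 * (u s * sigG hd s h) \in @Delta_pred k Q d.
  (* Replacing [M0] by [sigR s M0] lets equivariance form [sigR s M], which [u s] returns to [M]. *)
  apply: stable_actG hM0 _; rewrite actGM -[X in actG (sigG _ _ _) X](fixM0 s).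
  by rewrite -sig_act -eM hu.
apply: (@H2class_coboundary _ _ _ _ (fun s => MkDelta (delta_in s))).
  exact: Delta_mulC.
apply: (tcocycle_coboundary _ _ hM hu h) => s /=.
by rewrite (Delta_central h (delta_in s)) mulKVg.
Qed.

End TypeMap.

Theorem proposition3p15 (k : closedFieldType) (Q : quiver)
    (Sigma : {group qaut Q}) (d : vert Q -> nat) (theta : vert Q -> int)
    (hd : compatible Sigma d) (htheta : compatible Sigma theta) :
  range (@frs k Q d theta Sigma hd)
    `<=` @typemap k Q d theta Sigma hd @^-1` [set H2_1 _ _].
Proof.
move=> _ [o _ <-] /=; rewrite /typemap.
case: cid => -[M u] /= [oM hM hu].
(* [M] and [u] are the type map's arbitrary choices; the preimage [o] supplies a fixed [M0], and
   saturation puts [M] in its orbit. *)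
case: (svalP o) => M0 [fixM0 hM0] eo.
by move: (oM); rewrite eo saturateE => -[h]; exact: H2class_tcocycle_fixed.
Qed.
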